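(* Let $d\ge 1$ be an integer and let $\alpha_1,\dots,\alpha_d$ be real numbers with $\alpha_i>-1$ for all $i\in\{1,2,\dots,d\}$. Then the first positive zero $j_{\alpha,1}$ of the function $z\mapsto\mathcal{J}_{\alpha}(z)$ satisfies $$(d+1)^{d+1}A(\alpha)<j_{\alpha,1}^{d+1}<\frac{(d+1)^{d+1}A(\alpha)B(\alpha)}{B(\alpha)-A(\alpha)}$$ and $$(d+1)^{d+1}A(\alpha)\sqrt{\frac{B(\alpha)}{B(\alpha)-A(\alpha)}}<j_{\alpha,1}^{d+1}<\frac{2(d+1)^{d+1}\left(A(\alpha)B(\alpha)C(\alpha)-A(\alpha)^2C(\alpha)\right)}{A(\alpha)^2-3A(\alpha)C(\alpha)+2B(\alpha)C(\alpha)}.$$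
   Context: Write $\alpha=(\alpha_1,\dots,\alpha_d)$. The normalized hyper-Bessel function is the entire function $$\mathcal{J}_{\alpha}(z)=\sum_{n\ge 0}\frac{(-1)^n}{n!\,(\alpha_1+1)_n\cdots(\alpha_d+1)_n}\left(\frac{z}{d+1}\right)^{n(d+1)},$$ where $(\beta)_0=1$ and $(\beta)_n=\beta(\beta+1)\cdots(\beta+n-1)$ for $n\ge1$. Here $j_{\alpha,1}$ denotes the smallest positive zero of $\mathcal{J}_{\alpha}$. Further, $A(\alpha)=\prod_{i=1}^d(\alpha_i+1)$, $B(\alpha)=\prod_{i=1}^d(\alpha_i+2)$ and $C(\alpha)=\prod_{i=1}^d(\alpha_i+3)$. *)

(* Defs.v *)
From mathcomp Require Import all_boot all_order all_algebra.
From mathcomp Require Import all_classical all_reals all_analysis.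
From mathcomp Require Import complex.
Set Implicit Arguments.
Unset Strict Implicit.
Unset Printing Implicit Defensive.
Import Order.TTheory GRing.Theory Num.Theory.
Import numFieldNormedType.Exports.
Local Open Scope classical_set_scope.
Local Open Scope ring_scope.
Local Open Scope complex_scope.

Definition pochhammer (K : numFieldType) (b : K) (n : nat) : K :=
  \prod_(k < n) (b + k%:R).

Definition hyper_bessel (K : numFieldType) (d : nat) (alpha : 'I_d -> K)
    (z : K) : K :=
  lim (series (fun n : nat =>
    (-1) ^+ n / (n`!%:R * \prod_(i < d) pochhammer (alpha i + 1) n)
      * (z / d.+1%:R) ^+ (n * d.+1)) @ \oo).

(* The hyper-Bessel function with real parameters, as a function on the complex
   plane; its values are sums of convergent series, so that the [lim] above
   never takes its default value when every [alpha i] exceeds [-1]. *)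
Definition hyper_besselC (R : realType) (d : nat) (alpha : 'I_d -> R)
    (z : R[i]) : R[i] :=
  hyper_bessel (fun i => (alpha i)%:C) z.

Definition first_positive_zero (R : realType) (f : R[i] -> R[i]) (j : R) :
    Prop :=
  [/\ 0 < j, f j%:C = 0 & forall x : R, 0 < x -> f x%:C = 0 -> j <= x].

Definition A (R : realType) (d : nat) (alpha : 'I_d -> R) : R :=
  \prod_(i < d) (alpha i + 1).
Definition B (R : realType) (d : nat) (alpha : 'I_d -> R) : R :=
  \prod_(i < d) (alpha i + 2).
Definition C (R : realType) (d : nat) (alpha : 'I_d -> R) : R :=
  \prod_(i < d) (alpha i + 3).

(* Main.v *)
(* Put t = (z / (d+1))^(d+1), so that J_alpha(z) = F(t) with
   F(t) = sum_n (-1)^n e_n t^n and e_n = 1 / (n! prod_i (alpha_i+1)_n).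
   For c > 0 the operator p |-> p + X p' / c preserves products of factors
   1 - x X with x > 0.  Applying it to (1 - y X)^M with c = alpha_i + 1 + k,
   k < M, and letting M grow shows that F is a limit of such products.  Hence
   the least roots of the approximants accumulate at the first zero t of F, and
   the formal power sums s_1, s_2, s_3, s_4 attached to e_1, ..., e_4 by
   Newton's identities inherit the weak inequalities
     t^3 s_3 >= 1,  s_k - t s_(k+1) >= t (s_(k+1) - t s_(k+2)),  s_3 >= t s_4.
   All four bounds follow once s_2 > t s_3.  If s_2 = t s_3, then s_3 = t s_4
   too, and Newton's identities give, with P(n) = prod_i (alpha_i + 1 + n) and
   some kappa >= 0,
     1 / P(n) = 1 / P(0) - n / t + n kappa P(n - 1)   for n = 1, 2, 3.
   Convexity of P would then yield
     1 / P(0) - 3 / P(1) + 3 / P(2) - 1 / P(3)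
       = - 3 kappa (P(0) - 2 P(1) + P(2)) <= 0,
   although 1 / P is completely monotone. *)
Require Import Defs.
From mathcomp Require Import all_boot all_order all_algebra.
From mathcomp Require Import all_classical all_reals all_analysis.
From mathcomp Require Import complex ring lra.
Import Order.TTheory GRing.Theory Num.Theory.
Import numFieldNormedType.Exports.
Local Open Scope ring_scope.

Set Implicit Arguments.
Unset Strict Implicit.
Unset Printing Implicit Defensive.

(** * Products of factors 1 - x X with x > 0 *)

Lemma deriv_prod_1mX (K : fieldType) (s : seq K) (z : K) :
  all (fun x => 1 - x * z != 0) s ->
  (\prod_(x <- s) (1 - x *: 'X))^`().[z] =
    - (\prod_(x <- s) (1 - x *: 'X)).[z] * \sum_(x <- s) x / (1 - x * z).
Proof.
elim: s => [|x s IHs] /=; first by rewrite !big_nil mulr0 derivC horner0.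
case/andP=> xz_neq0 /IHs IH.
rewrite !big_cons derivM !hornerE IH derivB derivZ derivX derivC sub0r.
by rewrite !hornerE /=; field.
Qed.

Section Homography.
Local Open Scope complex_scope.

(** The denominator is the squared modulus of 1 - x z, so for x > 0 the imaginary part has the sign
    of Im z. *)
Lemma Im_homography (R : rcfType) (x : R) (z : R[i]) :
  complex.Im (x%:C * z / (1 - x%:C * z)) =
    x * complex.Im z /
      ((1 - x * complex.Re z) ^+ 2 + (x * complex.Im z) ^+ 2).
Proof.
by case: z => a b /=; rewrite !(mul0r, subr0, addr0, sub0r, sqrrN); ring.
Qed.

Lemma ImD (R : rcfType) (u v : R[i]) :
  complex.Im (u + v) = complex.Im u + complex.Im v.
Proof. by case: u; case: v. Qed.

Lemma Im_homography_sum_gt0 (R : rcfType) (s : seq R) (z : R[i]) :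
  all (fun x => 0 < x) s -> s != [::] -> complex.Im z != 0 ->
  0 < complex.Im z * complex.Im (\sum_(x <- s) x%:C * z / (1 - x%:C * z)).
Proof.
move=> + + Imz_neq0; elim: s => //= x s IHs /andP[x_gt0 s_gt0] _.
rewrite big_cons ImD mulrDr ltr_pwDl//.
  rewrite Im_homography mulrA mulrCA -expr2 divr_gt0//.
    by rewrite mulr_gt0// exprn_even_gt0.
  by rewrite ltr_wpDl ?sqr_ge0// exprn_even_gt0//= mulf_neq0// gt_eqF.
case: s IHs s_gt0 => [|y s] IHs ys_gt0; first by rewrite big_nil mulr0.
exact/ltW/IHs.
Qed.

(** A non-real z would make the sum non-real, and a real z <= 0 would make every term nonpositive,
    against c > 0. The empty list would force c = 0. *)
Lemma real_root_homography_sum (R : rcfType) (s : seq R) (c : R) (z : R[i]) :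
  all (fun x => 0 < x) s -> 0 < c ->
  \sum_(x <- s) x%:C * z / (1 - x%:C * z) = c%:C ->
  exists2 a : R, 0 < a & z = a%:C.
Proof.
move=> s_gt0 c_gt0 sum_eq.
have s_neq0 : s != [::].
  apply: contraTneq c_gt0 => s0; move: sum_eq; rewrite s0 big_nil => /esym/eqP.
  rewrite -(rmorph0 (real_complex R)) (inj_eq (@complexI R)) => /eqP ->.
  by rewrite ltxx.
have Imz0 : complex.Im z = 0.
  apply/eqP/negPn/negP => /(Im_homography_sum_gt0 s_gt0 s_neq0).
  by rewrite sum_eq /= mulr0 ltxx.
have zE : z = (complex.Re z)%:C by case: z Imz0 {sum_eq} => a b /= ->.
exists (complex.Re z) => //; rewrite ltNge; apply/negP => Rez_le0.
move: sum_eq; rewrite zE.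
under eq_bigr do
  rewrite -rmorphM -(rmorph1 (real_complex R)) -rmorphB -fmorph_div.
rewrite -rmorph_sum => /complexI sum_eq.
suff : c <= 0 by rewrite leNgt c_gt0.
rewrite -sum_eq; elim: (s) s_gt0 => [|x s' IHs] /=; first by rewrite big_nil.
case/andP=> x_gt0 /IHs; rewrite big_cons; apply: le_trans.
have xRez_le0 : x * complex.Re z <= 0 by rewrite mulr_ge0_le0// ltW.
by rewrite gerDr mulr_le0_ge0// invr_ge0 subr_ge0 (le_trans xRez_le0).
Qed.

(* If z is a root of p + X p' / c and not of p, then the logarithmic derivative
   of p gives sum_x x z / (1 - x z) = c; each term has an imaginary part of the
   sign of Im z, so z is real. *)
Lemma pos_product_stable (R : rcfType) (s : seq R) (c : R) :
  all (fun x => 0 < x) s -> 0 < c ->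
  exists2 s' : seq R, all (fun x => 0 < x) s' &
    \prod_(x <- s) (1 - x *: 'X) +
      c^-1 *: ('X * (\prod_(x <- s) (1 - x *: 'X))^`()) =
    \prod_(x <- s') (1 - x *: 'X).
Proof.
move=> s_gt0 c_gt0; set p := \prod_(x <- s) _; set q := p + _.
pose sC := [seq x%:C | x <- s].
pose toC := map_poly (real_complex R).
have factorE (x : R) : toC (1 - x *: 'X) = 1 - x%:C *: 'X.
  by rewrite /toC rmorphB rmorph1 /= map_polyZ /= map_polyX.
have pCE : toC p = \prod_(x <- sC) (1 - x *: 'X).
  rewrite /toC rmorph_prod big_map; apply: eq_bigr => x _; exact: factorE.
have qCE : toC q = toC p + c%:C^-1 *: ('X * (toC p)^`()).
  rewrite /toC rmorphD /= map_polyZ /= rmorphM /= map_polyX.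
  by rewrite deriv_map fmorphV.
have q0 : q.[0] = 1.
  rewrite !hornerE /= horner_prod big1_seq ?mulr0 ?mul0r ?addr0// => x _.
  by rewrite !hornerE ?mulr0 ?subr0.
have roots_pos z : root (toC q) z -> exists2 a : R, 0 < a & z = a%:C.
  have c_neq0 : c%:C != 0 by rewrite fmorph_eq0 gt_eqF.
  move=> qz; have [pz_neq0|] := boolP (all (fun x => 1 - x * z != 0) sC).
    apply: (real_root_homography_sum s_gt0 c_gt0); move/eqP: qz.
    have pz : (toC p).[z] != 0.
      rewrite pCE horner_prod prodf_seq_neq0; apply: sub_all pz_neq0 => x.
      by rewrite !hornerE.
    rewrite qCE {2}pCE !hornerE /= deriv_prod_1mX// -pCE.
    set S := \sum_(x <- _) _.
    have -> : (toC p).[z] + c%:C^-1 * z * (- (toC p).[z] * S) =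
       (toC p).[z] * (1 - c%:C^-1 * (z * S)) by ring.
    move=> /eqP; rewrite mulf_eq0 (negPf pz)/= subr_eq0 => /eqP S_eq.
    have -> : c%:C = z * S by rewrite -[LHS]mulr1 S_eq mulVKf.
    rewrite /S big_map mulr_sumr.
    by apply: eq_bigr => x _; rewrite [RHS]mulrCA mulrA.
  (* The remaining roots of [q] are roots of [p] as well, hence inverses of elements of [s]. *)
  rewrite -has_predC => /hasP[_ /mapP[x x_in ->]] /=.
  rewrite negbK subr_eq0 => /eqP xz1.
  have x_gt0 := allP s_gt0 _ x_in.
  exists x^-1; first by rewrite invr_gt0.
  have xC0 : x%:C != 0 by rewrite fmorph_eq0 gt_eqF.
  by rewrite fmorphV -[LHS](mulKf xC0) -xz1 mulr1.
have [r rE] := closed_field_poly_normal (toC q).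
have r_pos z : z \in r -> exists2 a : R, 0 < a & z = a%:C.
  move=> z_in; apply: roots_pos; rewrite rE rootZ ?root_prod_XsubC//.
  rewrite lead_coef_eq0 map_poly_eq0; apply: contra_eqN q0 => /eqP ->.
  by rewrite horner0 eq_sym oner_eq0.
exists [seq (complex.Re z)^-1 | z <- r].
  rewrite all_map; apply/allP => z /r_pos[a a_gt0 ->] /=.
  by rewrite invr_gt0.
apply: (map_poly_inj (real_complex R)); rewrite -/(toC q) rmorph_prod big_map.
have prodE : \prod_(z <- r) ('X - z%:P) =
    (\prod_(z <- r) (- z))%:P *
    \prod_(z <- r) toC (1 - (complex.Re z)^-1 *: 'X).
  rewrite rmorph_prod -big_split; apply: eq_big_seq => z /r_pos[a a_gt0 ->] /=.
  rewrite factorE mul_polyC scalerBr scalerA fmorphV mulNr.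
  rewrite divff ?fmorph_eq0 ?gt_eqF// -[_%:A]mul_polyC mulr1 polyCN scaleN1r.
  by rewrite opprK addrC.
have qC0 : (toC q).[0] = 1.
  by rewrite -(rmorph0 (real_complex R)) horner_map q0 rmorph1.
(* All scalars are collected in [L]. At 0 both [q] and every factor equal 1, which forces [L] =
   1. *)
have [L qCprod] : exists L, toC q =
    L%:P * \prod_(z <- r) toC (1 - (complex.Re z)^-1 *: 'X).
  exists (lead_coef (toC q) * \prod_(z <- r) (- z)).
  by rewrite {1}rE prodE -mul_polyC mulrA -polyCM.
rewrite [LHS]qCprod; move: qC0; rewrite qCprod hornerM hornerC horner_prod.
rewrite big1_seq ?mulr1 => [->|z _]; first by rewrite mul1r.
by rewrite factorE !hornerE ?mulr0 ?subr0.
Qed.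
End Homography.

Definition pos_product (R : rcfType) (p : {poly R}) : Prop :=
  exists2 s : seq R, all (fun x => 0 < x) s & p = \prod_(x <- s) (1 - x *: 'X).

(** The operator p + X p' / c is diagonal on monomials, since X p' multiplies the n-th coefficient
    by n. *)
Lemma pos_product_euler (R : rcfType) (p : {poly R}) (c : R) :
  pos_product p -> 0 < c ->
  exists2 q, pos_product q & forall n, q`_n = p`_n * ((c + n%:R) / c).
Proof.
move=> [s s_gt0 ->] c_gt0.
have [s' s'_gt0 eq_s'] := pos_product_stable s_gt0 c_gt0.
exists (\prod_(x <- s') (1 - x *: 'X)) => [|n]; first by exists s'.
rewrite -eq_s' coefD coefZ coefXM coef_deriv.
have c_neq0 : c != 0 by rewrite gt_eqF.
case: n => [|n] /=; first by rewrite addr0 divff// mulr0 addr0 mulr1.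
by rewrite -mulr_natl; field.
Qed.

Lemma pochhammerS (R : numFieldType) (b : R) n :
  pochhammer b n.+1 = pochhammer b n * (b + n%:R).
Proof. by rewrite /pochhammer big_ord_recr. Qed.

Lemma pochhammer_shift (R : numFieldType) (b : R) n :
  b * pochhammer (b + 1) n = pochhammer b n * (b + n%:R).
Proof.
rewrite -pochhammerS /pochhammer big_ord_recl addr0; congr (_ * _).
by apply: eq_bigr => i _; rewrite lift0 -natr1 -addrA [1 + _]addrC.
Qed.

Lemma pochhammer_gt0 (R : numFieldType) (b : R) n : 0 < b -> 0 < pochhammer b n.
Proof. by move=> b_gt0; apply: prodr_gt0 => i _; rewrite ltr_wpDr. Qed.

(** Apply the operators with c = b, b + 1, ..., b + K - 1: the product over k < K of the multipliers
    (b + k + n) / (b + k) is (b + K)_n / (b)_n. *)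
Lemma pos_product_pochhammer (R : rcfType) (p : {poly R}) (b : R) (K : nat) :
  pos_product p -> 0 < b ->
  exists2 q, pos_product q &
    forall n, q`_n = p`_n * (pochhammer (b + K%:R) n / pochhammer b n).
Proof.
move=> p_pos b_gt0; have poch_neq0 n : pochhammer b n != 0.
  by rewrite gt_eqF// pochhammer_gt0.
elim: K => [|K [q q_pos qE]].
  by exists p => // n; rewrite addr0 divff// mulr1.
have bK_gt0 : 0 < b + K%:R by rewrite ltr_wpDr.
have [q' q'_pos q'E] := pos_product_euler q_pos bK_gt0.
exists q' => // n; rewrite q'E qE -mulrA; congr (_ * _).
rewrite -natr1 addrA mulrAC mulrA -pochhammer_shift.
by field; rewrite poch_neq0 gt_eqF.
Qed.

Lemma pos_product_pochhammer_prod (R : rcfType) (I : eqType) (r : seq I)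
    (b : I -> R) (p : {poly R}) (K : nat) :
  pos_product p -> (forall i, 0 < b i) ->
  exists2 q, pos_product q & forall n, q`_n =
    p`_n * \prod_(i <- r) (pochhammer (b i + K%:R) n / pochhammer (b i) n).
Proof.
move=> p_pos b_gt0; elim: r => [|i r [q q_pos qE]].
  by exists p => // n; rewrite big_nil mulr1.
have [q' q'_pos q'E] := pos_product_pochhammer K q_pos (b_gt0 i).
exists q' => // n; rewrite q'E qE big_cons -mulrA; congr (_ * _).
exact: mulrC.
Qed.

(* The k-th power sum in terms of the elementary symmetric polynomials. *)
Definition newton2 (R : pzRingType) (e1 e2 : R) : R := e1 ^+ 2 - 2 * e2.
Definition newton3 (R : pzRingType) (e1 e2 e3 : R) : R :=
  e1 ^+ 3 - 3 * e1 * e2 + 3 * e3.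
Definition newton4 (R : pzRingType) (e1 e2 e3 e4 : R) : R :=
  e1 ^+ 4 - 4 * e1 ^+ 2 * e2 + 2 * e2 ^+ 2 + 4 * e1 * e3 - 4 * e4.

(** The k-th coefficient of the product is (-1)^k e_k, whence the signs in front of [p]_1[and]p[_3].
    Newton's identities are checked by adding one factor at a time. *)
Lemma power_sums_coef (R : fieldType) (s : seq R)
    (p := \prod_(x <- s) (1 - x *: 'X)) :
  [/\ p`_0 = 1, \sum_(x <- s) x = - p`_1,
      \sum_(x <- s) x ^+ 2 = newton2 (- p`_1) p`_2,
      \sum_(x <- s) x ^+ 3 = newton3 (- p`_1) p`_2 (- p`_3) &
      \sum_(x <- s) x ^+ 4 = newton4 (- p`_1) p`_2 (- p`_3) p`_4].
Proof.
rewrite /newton2 /newton3 /newton4 {}/p.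
elim: s => [|x s]; first by rewrite !big_nil !coefC /=; split=> //; ring.
rewrite !big_cons; set p := \prod_(x <- s) _ => -[p0 -> -> -> ->].
rewrite !mulrBl !mul1r -scalerAl !coefB !coefZ !coefXM /= p0.
by split; ring.
Qed.

(** * The least root and the power sums *)

Lemma max_in_seq (R : realDomainType) (s : seq R) :
  s != [::] -> exists2 m, m \in s & {in s, forall x, x <= m}.
Proof.
elim: s => // x [|y s] IHs _.
  by exists x => [|z]; rewrite inE// => /eqP ->.
have [//|m m_in m_max] := IHs.
have [xm|mx] := leP x m.
  exists m => [|z]; rewrite inE ?m_in ?orbT// => /predU1P[-> //|]; exact: m_max.
exists x => [|z]; rewrite inE ?eqxx// => /predU1P[-> //|/m_max /le_trans]; apply.
exact: ltW.
Qed.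

(** Invert exp (y / (1 - r)) >= 1 + y / (1 - r) >= 1 + y / (1 - y) = 1 / (1 - y). *)
Lemma expR_le_1B (R : realType) (y r : R) : 0 <= y -> y <= r -> r < 1 ->
  expR (- y / (1 - r)) <= 1 - y.
Proof.
move=> y_ge0 y_le r_lt1.
have y_lt1 : 0 < 1 - y by rewrite subr_gt0 (le_lt_trans y_le).
have r_lt : 0 < 1 - r by rewrite subr_gt0.
rewrite mulNr expRN -[leRHS]invrK lef_pV2 ?posrE ?expR_gt0 ?invr_gt0//.
apply: le_trans (expR_ge1Dx _).
have -> : (1 - y)^-1 = 1 + y / (1 - y) by field; rewrite gt_eqF.
by rewrite lerD2l ler_wpM2l// lef_pV2 ?posrE// lerD2l lerN2.
Qed.

(** The lower bound sees only the sum of the list and not its length, so it survives when the number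
    of factors grows. *)
Lemma prod_1B_ge_expR (R : realType) (s : seq R) (t r : R) :
  0 <= t -> r < 1 -> {in s, forall x, 0 <= x /\ t * x <= r} ->
  expR (- (t * \sum_(x <- s) x) / (1 - r)) <= \prod_(x <- s) (1 - x * t).
Proof.
move=> t_ge0 r_lt1; elim: s => [_|x s IHs s_le].
  by rewrite !big_nil mulr0 oppr0 mul0r expR0.
have [x_ge0 x_le] := s_le x (mem_head _ _).
rewrite !big_cons mulrDr opprD mulrDl expRD ler_pM ?expR_ge0//.
  by rewrite [x * t]mulrC expR_le_1B// mulr_ge0.
by apply: IHs => y y_in; apply: s_le; rewrite inE y_in orbT.
Qed.


(** The least root is 1 / m for the largest m in the list. The inequalities say that a power sum
    dominates its term m^k and that the sums of x^k (1 - t x)^2, k = 1, 2, and of x^3 (1 - t x) are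
    nonnegative. The exponential bound stands in for positivity before t, which alone would weaken
    to >= 0 in a limit. *)
Lemma pos_product_least_root (R : realType) (p : {poly R})
    (s1 := - p`_1) (s2 := newton2 (- p`_1) p`_2)
    (s3 := newton3 (- p`_1) p`_2 (- p`_3))
    (s4 := newton4 (- p`_1) p`_2 (- p`_3) p`_4) :
  pos_product p -> s1 != 0 ->
  exists t : R, [/\ 0 < t, p.[t] = 0,
    forall u r : R, 0 <= u -> u <= r * t -> 0 <= r -> r < 1 ->
      expR (- (u * s1) / (1 - r)) <= p.[u] &
    [/\ 1 <= t * s1, 1 <= t ^+ 3 * s3, t * (s2 - t * s3) <= s1 - t * s2,
      t * (s3 - t * s4) <= s2 - t * s3 & t * s4 <= s3]].
Proof.
move=> [s s_gt0 pE]; rewrite {}/s1 {}/s2 {}/s3 {}/s4 pE.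
have [_ <- <- <- <-] := power_sums_coef s => s1_neq0.
have {}s_gt0 x : x \in s -> 0 < x by move/(allP s_gt0).
have [|m m_in m_max] := @max_in_seq _ s.
  by apply: contraNneq s1_neq0 => ->; rewrite big_nil.
have m_gt0 := s_gt0 _ m_in; have m_neq0 : m != 0 by rewrite gt_eqF.
have x_le1 x : x \in s -> m^-1 * x <= 1.
  by move=> /m_max; rewrite ler_pdivrMl// mulr1.
have term_le k : m ^+ k <= \sum_(x <- s) x ^+ k.
  rewrite (big_rem m)//= lerDl big_seq sumr_ge0// => x /mem_rem /s_gt0 /ltW.
  exact: exprn_ge0.
have defect k : 0 <= \sum_(x <- s) x ^+ k * (1 - m^-1 * x) ^+ 2.
  rewrite big_seq sumr_ge0// => x /s_gt0 x_gt0.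
  by rewrite mulr_ge0 ?sqr_ge0 ?exprn_ge0 1?ltW.
have defectE k : \sum_(x <- s) x ^+ k * (1 - m^-1 * x) ^+ 2 =
    (\sum_(x <- s) x ^+ k - m^-1 * \sum_(x <- s) x ^+ k.+1) -
    m^-1 * (\sum_(x <- s) x ^+ k.+1 - m^-1 * \sum_(x <- s) x ^+ k.+2).
  rewrite !mulr_sumr -!sumrB !mulr_sumr -!sumrB; apply: eq_bigr => x _.
  by rewrite !exprS; ring.
exists m^-1; rewrite invr_gt0; split=> //.
- rewrite horner_prod (big_rem m)//= !hornerE divff//.
  by rewrite subrr mul0r.
- move=> u r u_ge0 u_le r_ge0 r_lt1; rewrite horner_prod.
  under eq_bigr do rewrite !hornerE.
  apply: prod_1B_ge_expR => // x x_in; have x_gt0 := s_gt0 _ x_in.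
  split; first exact: ltW.
  rewrite (le_trans (ler_wpM2r (ltW x_gt0) u_le))// -mulrA ler_piMr ?x_le1//.
have sumE : \sum_(x <- s) x = \sum_(x <- s) x ^+ 1 by [].
split.
- by rewrite ler_pdivlMl// mulr1 sumE (le_trans _ (term_le 1)).
- by rewrite exprVn mulrC ler_pdivlMr ?exprn_gt0// mul1r.
- by rewrite -subr_ge0 sumE -defectE.
- by rewrite -subr_ge0 -defectE.
- rewrite -subr_ge0 mulr_sumr -sumrB big_seq sumr_ge0// => x x_in.
  have x_gt0 := s_gt0 _ x_in.
  have -> : x ^+ 3 - m^-1 * x ^+ 4 = x ^+ 3 * (1 - m^-1 * x) by ring.
  by rewrite mulr_ge0 ?subr_ge0 ?x_le1 ?exprn_ge0 ?(ltW x_gt0).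
Qed.

(** * Strictness of the inequalities *)

Definition increasing_convex (R : realFieldType) (u : nat -> R) : Prop :=
  [/\ 0 < u 0%N, 0 <= u 1%N - u 0%N & 0 <= u 0%N - 2 * u 1%N + u 2%N].

(** Discrete Leibniz rule: the differences at 0 of a product are combinations, with nonnegative
    coefficients, of products of differences at 0. *)
Lemma increasing_convexM (R : realFieldType) (u v : nat -> R) :
  increasing_convex u -> increasing_convex v ->
  increasing_convex (fun n => u n * v n).
Proof.
move=> [u0 du ddu] [v0 dv ddv]; split; first exact: mulr_gt0.
  have -> : u 1%N * v 1%N - u 0%N * v 0%N =
    u 0%N * (v 1%N - v 0%N) + (u 1%N - u 0%N) * v 0%N +
    (u 1%N - u 0%N) * (v 1%N - v 0%N) by ring.
  by do ![by [] | exact: ltW | apply: mulr_ge0 | apply: addr_ge0].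
set du' := u 1%N - u 0%N in du *; set dv' := v 1%N - v 0%N in dv *.
set ddu' := _ + u 2%N in ddu *; set ddv' := _ + v 2%N in ddv *.
have -> : u 0%N * v 0%N - 2 * (u 1%N * v 1%N) + u 2%N * v 2%N =
  u 0%N * ddv' + ddu' * v 0%N + 2 * du' * dv' + 2 * du' * ddv' +
  2 * ddu' * dv' + ddu' * ddv' by rewrite /du' /dv' /ddu' /ddv'; ring.
by do ![by [] | exact: ltW | apply: mulr_ge0 | apply: addr_ge0].
Qed.

(** All differences are anchored at index 3; from there those of a product expand with nonnegative
    coefficients only. *)
Definition completely_monotone3 (R : realFieldType) (u : nat -> R) : Prop :=
  [/\ 0 < u 3%N, 0 <= u 2%N - u 3%N, 0 <= u 1%N - 2 * u 2%N + u 3%N &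
      0 <= u 0%N - 3 * u 1%N + 3 * u 2%N - u 3%N].

(** The term [a3 * v 3] is set apart as the one whose strict positivity is used later. *)
Lemma third_differenceM (R : realFieldType) (u v : nat -> R)
    (a1 := u 2%N - u 3%N) (a2 := u 1%N - 2 * u 2%N + u 3%N)
    (a3 := u 0%N - 3 * u 1%N + 3 * u 2%N - u 3%N)
    (b1 := v 2%N - v 3%N) (b2 := v 1%N - 2 * v 2%N + v 3%N)
    (b3 := v 0%N - 3 * v 1%N + 3 * v 2%N - v 3%N) :
  u 0%N * v 0%N - 3 * (u 1%N * v 1%N) + 3 * (u 2%N * v 2%N) - u 3%N * v 3%N =
  a3 * v 3%N + (u 3%N * b3 + 3 * (a1 * b2) + 3 * (a2 * b1) + 3 * (a1 * b3)
  + 3 * (a3 * b1) + 6 * (a2 * b2) + 3 * (a2 * b3) + 3 * (a3 * b2) + a3 * b3).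
Proof. by rewrite /a1 /a2 /a3 /b1 /b2 /b3; ring. Qed.

Lemma completely_monotone3M (R : realFieldType) (u v : nat -> R) :
  completely_monotone3 u -> completely_monotone3 v ->
  completely_monotone3 (fun n => u n * v n).
Proof.
move=> [u3 a1 a2 a3] [v3 b1 b2 b3]; split.
- exact: mulr_gt0.
- rewrite [leRHS](_ : _ = u 3%N * (v 2%N - v 3%N) + (u 2%N - u 3%N) * v 3%N +
    (u 2%N - u 3%N) * (v 2%N - v 3%N)); last by ring.
  by do ![by [] | exact: ltW | apply: mulr_ge0 | apply: addr_ge0].
- rewrite [leRHS](_ : _ = u 3%N * (v 1%N - 2 * v 2%N + v 3%N) +
    (u 1%N - 2 * u 2%N + u 3%N) * v 3%N +
    2 * ((u 2%N - u 3%N) * (v 2%N - v 3%N)) +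
    2 * ((u 2%N - u 3%N) * (v 1%N - 2 * v 2%N + v 3%N)) +
    2 * ((u 1%N - 2 * u 2%N + u 3%N) * (v 2%N - v 3%N)) +
    (u 1%N - 2 * u 2%N + u 3%N) * (v 1%N - 2 * v 2%N + v 3%N)); last by ring.
  by do ![by [] | exact: ltW | apply: mulr_ge0 | apply: addr_ge0].
- rewrite third_differenceM.
  by do ![by [] | exact: ltW | apply: mulr_ge0 | apply: addr_ge0].
Qed.

Lemma increasing_convex_shift (R : realFieldType) (b : R) :
  0 < b -> increasing_convex (fun n => b + n%:R).
Proof. by move=> b_gt0; split; lra. Qed.

Lemma increasing_convex_prod (R : realFieldType) (I : Type) (r : seq I)
    (b : I -> R) :
  (forall i, 0 < b i) ->
  increasing_convex (fun n => \prod_(i <- r) (b i + n%:R)).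
Proof.
move=> b_gt0; elim: r => [|i r IHr].
  by split; rewrite !big_nil; lra.
have := increasing_convexM (increasing_convex_shift (b_gt0 i)) IHr.
by rewrite /increasing_convex !big_cons.
Qed.

(** The difference of order k = 1, 2, 3 is k! times a product of k + 1 values of [u]. *)
Lemma third_difference_shiftV_gt0 (R : realFieldType) (b : R)
    (u := fun n => (b + n%:R)^-1) :
  0 < b -> completely_monotone3 u /\ 0 < u 0%N - 3 * u 1%N + 3 * u 2%N - u 3%N.
Proof.
move=> b_gt0; have u_gt0 n : 0 < u n by rewrite invr_gt0 ltr_wpDr.
have b_neq0 n : b + n%:R != 0 by rewrite gt_eqF// ltr_wpDr.
have := (b_neq0 0%N, b_neq0 1%N, b_neq0 2%N, b_neq0 3%N).
rewrite addr0 => -[[[b0 b1] b2] b3].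
have d1 : u 2%N - u 3%N = u 2%N * u 3%N by rewrite /u; field; rewrite b2 b3.
have d2 : u 1%N - 2 * u 2%N + u 3%N = 2 * (u 1%N * (u 2%N * u 3%N)).
  by rewrite /u; field; rewrite b1 b2 b3.
have d3 : u 0%N - 3 * u 1%N + 3 * u 2%N - u 3%N =
    6 * (u 0%N * (u 1%N * (u 2%N * u 3%N))).
  by rewrite /u addr0; field; rewrite b0 b1 b2 b3.
have pos3 : 0 < u 0%N - 3 * u 1%N + 3 * u 2%N - u 3%N.
  by rewrite d3 !mulr_gt0.
split=> //; split=> //; last exact: ltW.
- by rewrite d1 mulr_ge0 ?ltW.
- by rewrite d2 !mulr_ge0 ?ltW.
Qed.

Lemma completely_monotone3_prod (R : realFieldType) (I : Type) (r : seq I)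
    (b : I -> R) :
  (forall i, 0 < b i) ->
  completely_monotone3 (fun n => (\prod_(i <- r) (b i + n%:R))^-1).
Proof.
move=> b_gt0; elim: r => [|i r IHr].
  by split; rewrite !big_nil invr1; lra.
have [cm_i _] := third_difference_shiftV_gt0 (b_gt0 i).
have := completely_monotone3M cm_i IHr.
by rewrite /completely_monotone3 !big_cons !invfM.
Qed.

(** The first factor supplies strictness, which the others preserve. An empty product has third
    difference 0, hence the index [d.+1]. *)
Lemma third_difference_prodV_gt0 (R : realFieldType) (d : nat)
    (b : 'I_d.+1 -> R)
    (u := fun n => (\prod_(i < d.+1) (b i + n%:R))^-1) :
  (forall i, 0 < b i) -> 0 < u 0%N - 3 * u 1%N + 3 * u 2%N - u 3%N.
Proof.
move=> b_gt0.
have [[x3 x1 x2 _] pos] := third_difference_shiftV_gt0 (b_gt0 ord0).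
have [y3 y1 y2 y4] := completely_monotone3_prod (index_enum 'I_d)
  (b := b \o lift ord0) (fun i => b_gt0 _).
rewrite /u !big_ord_recl !invfM.
rewrite (third_differenceM (fun n => (b ord0 + n%:R)^-1)
  (fun n => (\prod_(i < d) (b (lift ord0 i) + n%:R))^-1)) /=.
rewrite ltr_pwDl ?mulr_gt0//.
by do ![by [] | exact: ltW | apply: mulr_ge0 | apply: addr_ge0].
Qed.

(** The crux is s_2 > t s_3: it gives t^2 s_2 > t^3 s_3 >= 1 and e_1 - t s_2 >= t (s_2 - t s_3) >
    0. *)
Lemma least_root_bounds (R : realFieldType) (P0 P1 P2 P3 t : R)
    (e1 := P0^-1) (e2 := (2 * P0 * P1)^-1) (e3 := (6 * P0 * P1 * P2)^-1)
    (e4 := (24 * P0 * P1 * P2 * P3)^-1) (s2 := newton2 e1 e2)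
    (s3 := newton3 e1 e2 e3) (s4 := newton4 e1 e2 e3 e4) :
  0 < P0 -> 0 < P1 -> 0 < P2 -> 0 < P3 -> 0 <= P0 - 2 * P1 + P2 ->
  0 < P0^-1 - 3 * P1^-1 + 3 * P2^-1 - P3^-1 -> 0 < t ->
  [/\ 1 <= t ^+ 3 * s3, t * (s2 - t * s3) <= e1 - t * s2,
      t * (s3 - t * s4) <= s2 - t * s3 & t * s4 <= s3] ->
  [/\ 1 < t ^+ 2 * s2, t * s3 < s2 & t * s2 < e1].
Proof.
move=> P0_gt0 P1_gt0 P2_gt0 P3_gt0 convex cm t_gt0 [s3_ge s12 s23 s34].
have [P0n P1n P2n P3n tn] : [/\ P0 != 0, P1 != 0, P2 != 0, P3 != 0 & t != 0].
  by rewrite !gt_eqF.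
have s23_ge0 : 0 <= t * (s3 - t * s4).
  by rewrite mulr_ge0 ?(ltW t_gt0) ?subr_ge0.
have s23_gt0 : 0 < s2 - t * s3.
  rewrite lt_neqAle eq_sym (le_trans s23_ge0 s23) andbT.
  apply/negP => /eqP s23_eq0; rewrite s23_eq0 mulr0 in s12 s23.
  have s34_eq0 : s3 - t * s4 = 0.
    by apply/eqP; rewrite -(mulrI_eq0 _ (lregP tn)) eq_le s23.
  (* In the case of equality s_2, s_3, s_4 are geometric with ratio 1 / t; [kappa] measures how far
     s_1 exceeds this pattern. *)
  pose kappa := (e1 - t * s2) / t.
  have kappa_ge0 : 0 <= kappa by rewrite divr_ge0 ?(ltW t_gt0).
  (* The null terms [s2 - t * s3] and [s3 - t * s4] are put back below, so that
     the equations become rational identities in the P's and [t]. *)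
  have q1E : P1^-1 = P0^-1 - t^-1 + kappa * P0.
    by rewrite /kappa /s2 /newton2 /e1 /e2; field; rewrite tn P0n P1n.
  have q2E : P2^-1 = P0^-1 - 2 * t^-1 + 2 * kappa * P1.
    rewrite -[RHS]addr0 -[X in _ + X](mulr0 (- (2 * P0 * P1 / t))) -s23_eq0.
    rewrite /kappa /s2 /s3 /newton2 /newton3 /e1 /e2 /e3.
    by field; rewrite tn P0n P1n P2n.
  have q3E : P3^-1 = P0^-1 - 3 * t^-1 + 3 * kappa * P2.
    rewrite -[RHS]addr0 -[X in _ + X](mulr0 (- (6 * P1 * P2 / t))) -s23_eq0.
    rewrite -[RHS]addr0 -[X in _ + X](mulr0 (6 * P0 * P1 * P2 / t)) -s34_eq0.
    rewrite /kappa /s2 /s3 /s4 /newton2 /newton3 /newton4 /e1 /e2 /e3 /e4.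
    by field; rewrite tn P0n P1n P2n P3n.
  have : P0^-1 - 3 * P1^-1 + 3 * P2^-1 - P3^-1 <= 0.
    have -> : P0^-1 - 3 * P1^-1 + 3 * P2^-1 - P3^-1 =
      - (3 * kappa * (P0 - 2 * P1 + P2)) by rewrite q1E q2E q3E; ring.
    by rewrite oppr_le0; apply: mulr_ge0 => //; apply: mulr_ge0.
  by rewrite leNgt cm.
split; rewrite -subr_gt0 //.
- have -> : t ^+ 2 * s2 - 1 =
    t ^+ 2 * (s2 - t * s3) + (t ^+ 3 * s3 - 1) by ring.
  by rewrite ltr_pwDl ?subr_ge0// mulr_gt0 ?exprn_gt0.
- exact: lt_le_trans (mulr_gt0 t_gt0 s23_gt0) s12.
Qed.

(** * Approximation of the hyper-Bessel series *)

Local Open Scope classical_set_scope.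

Lemma series_tail_bound (R : realType) (u v : R ^nat) (l : R) (m : nat) :
  (forall n, `|u n| <= v n) -> cvgn (series v) -> series u @ \oo --> l ->
  `|l - series u m| <= limn (series v) - series v m.
Proof.
move=> uv v_cvg u_cvg.
have lhs_cvg : (fun k => `|series u k - series u m|) @ \oo -->
    `|l - series u m|.
  by apply: cvg_norm; apply: cvgB => //; exact: cvg_cst.
have rhs_cvg : (fun k => series v k - series v m) @ \oo -->
    limn (series v) - series v m by apply: cvgB => //; exact: cvg_cst.
apply: ler_cvg_to lhs_cvg rhs_cvg _; near=> k.
have mk : (m <= k)%N by near: k; exists m.
rewrite !sub_series_geq// (le_trans (ler_norm_sum _ _ _))// ler_sum//.
Unshelve. all: by end_near. Qed.

(** Dominated convergence for series. The filter is arbitrary because the limit is later taken along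
    one obtained from compactness. *)
Lemma tannery (R : realType) (F : set_system nat) (g : nat -> R ^nat)
    (a v h : R ^nat) :
  ProperFilter F -> (\forall N \near F, forall n, `|g N n| <= v n) ->
  cvgn (series v) -> (forall n, g ^~ n @ F --> a n) ->
  (forall N, series (g N) @ \oo --> h N) ->
  cvgn (series a) /\ h @ F --> limn (series a).
Proof.
move=> FF gv v_cvg ga gh.
have av n : `|a n| <= v n.
  apply: cvgr_to_le (cvg_norm (ga n)) _; near=> N.
  by have : forall n, `|g N n| <= v n by near: N.
have a_cvg : cvgn (series a).
  apply: normed_cvg; apply: series_le_cvg v_cvg => n //=.
  exact: le_trans (av n).
split=> //; apply/cvgrPdist_le => e e_gt0.
have [m tail_m] : exists m, limn (series v) - series v m <= e / 3.
  have /cvgrPdist_le/(_ (e / 3)) : series v @ \oo --> limn (series v) by [].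
  move=> /(_ _) [|m _ /(_ m (leqnn m))]; first by rewrite divr_gt0.
  by move=> /(le_trans (ler_norm _)) ?; exists m.
have partial_cvg : (fun N => series (g N) m) @ F --> series a m.
  by apply: cvg_big => [|n _]; [exact: add_continuous | exact: ga].
near=> N.
have gvN : forall n, `|g N n| <= v n by near: N.
have partial_N : `|series a m - series (g N) m| <= e / 3.
  by near: N; move/cvgrPdist_le : partial_cvg; apply; rewrite divr_gt0.
have tail_a := series_tail_bound m av v_cvg a_cvg.
have tail_g := series_tail_bound m gvN v_cvg (gh N).
have -> : limn (series a) - h N = (limn (series a) - series a m) +
  (series a m - series (g N) m) - (h N - series (g N) m) by ring.
rewrite (le_trans (ler_normB _ _))//.
rewrite (le_trans (lerD (ler_normD _ _) (lexx _)))//.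
lra.
Unshelve. all: by end_near. Qed.

Lemma series_coef_poly (R : realType) (p : {poly R}) (t : R) :
  series (fun n => p`_n * t ^+ n) @ \oo --> p.[t].
Proof.
apply: cvg_near_cst; near=> n.
rewrite /series /= big_mkord; apply/esym/horner_coef_wide.
by near: n; exists (size p).
Unshelve. all: by end_near. Qed.

Lemma cvg_eq_lim (R : realType) (T : Type) (F : set_system T) (f : T -> R)
    (k l : R) : k = l -> f @ F --> k -> f @ F --> l.
Proof. by move=> ->. Qed.

Definition bessel_coef (R : realType) (d : nat) (b : 'I_d -> R) (n : nat) : R :=
  (n`!%:R * \prod_(i < d) pochhammer (b i) n)^-1.

(* With M = N + 1, the coefficients, up to sign, of the polynomial obtained from
   (1 - M^-(d+1) X)^M by the operators p |-> p + X p' / (b_i + k), k < M. *)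
Definition approx_coef (R : realType) (d : nat) (b : 'I_d -> R) (N n : nat) :
    R :=
  'C(N.+1, n)%:R / N.+1%:R ^+ n *
  \prod_(i < d)
    (pochhammer (b i + N.+1%:R) n / N.+1%:R ^+ n / pochhammer (b i) n).

Lemma binomial_pos_product (R : rcfType) (y : R) (M : nat) :
  0 < y -> exists2 p : {poly R}, pos_product p &
    forall n, p`_n = (-1) ^+ n * ('C(M, n)%:R * y ^+ n).
Proof.
move=> y_gt0; exists (\prod_(x <- nseq M y) (1 - x *: 'X)).
  by exists (nseq M y) => //; rewrite all_nseq y_gt0 orbT.
move=> n; rewrite big_nseq -Monoid.iteropE.
rewrite -[iterop _ _ _ _]/((1 - y *: 'X) ^+ M).
have -> : (1 - y *: 'X) ^+ M =
    \poly_(i < M.+1) ((-1) ^+ i * ('C(M, i)%:R * y ^+ i)).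
  rewrite poly_def -scaleNr exprDn; apply: eq_bigr => i _.
  rewrite expr1n mul1r exprZn -scaler_nat scalerA; congr (_ *: _).
  by rewrite -mulN1r exprMn mulrCA.
rewrite coef_poly; case: ltnP => // Mn.
by rewrite bin_small// mul0r mulr0.
Qed.

Lemma approx_pos_product (R : realType) (d : nat) (b : 'I_d -> R) (N : nat) :
  (forall i, 0 < b i) -> exists2 p : {poly R}, pos_product p &
    forall n, p`_n = (-1) ^+ n * approx_coef b N n.
Proof.
move=> b_gt0.
(* Of the d + 1 powers of [N.+1], one normalizes the binomial coefficient and the others the d
   Pochhammer ratios. *)
have y_gt0 : 0 < N.+1%:R ^- d.+1 :> R by rewrite invr_gt0 exprn_gt0.
have [p p_pos pE] := binomial_pos_product N.+1 y_gt0.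
have [q q_pos qE] :=
  pos_product_pochhammer_prod (index_enum 'I_d) N.+1 p_pos b_gt0.
exists q => // n; rewrite qE pE -mulrA; congr (_ * _); rewrite /approx_coef.
under [in RHS]eq_bigr do rewrite mulrAC.
rewrite [in RHS]big_split /= big_const_ord iter_mulr_1 -!exprVn exprAC exprS.
by rewrite -!mulrA; congr (_ * (_ * _)); exact: mulrC.
Qed.

Lemma cvg_pochhammer_ratio (R : realType) (b : R) (n : nat) :
  (fun N => pochhammer (b + N.+1%:R) n / N.+1%:R ^+ n) @ \oo --> (1 : R).
Proof.
have ratioE N : pochhammer (b + N.+1%:R) n / N.+1%:R ^+ n =
    \prod_(k < n) (1 + (b + k%:R) * harmonic N).
  rewrite -[n in _ ^+ n]card_ord -prodr_const -prodf_div; apply: eq_bigr => k _.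
  by rewrite /harmonic /=; field; rewrite nat1r pnatr_eq0.
have : (fun N => \prod_(k < n) (1 + (b + k%:R) * harmonic N)) @ \oo -->
    \prod_(k < n) (1 + (b + k%:R) * 0).
  apply: (cvg_big mul_continuous) => k _.
  apply: cvgD; first exact: cvg_cst.
  by apply: cvgM; [exact: cvg_cst | exact: cvg_harmonic].
rewrite big1 => [|k _]; last by rewrite mulr0 addr0.
by under eq_cvg do rewrite -ratioE.
Qed.

Lemma cvg_binomial_ratio (R : realType) (n : nat) :
  (fun N => 'C(N.+1, n)%:R / N.+1%:R ^+ n) @ \oo --> (n`!%:R^-1 : R).
Proof.
have binE N : 'C(N.+1, n)%:R / N.+1%:R ^+ n =
    (N.+1 ^_ n)%:R / N.+1%:R ^+ n * n`!%:R^-1 :> R.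
  rewrite -bin_ffact natrM mulrAC mulfK// ?pnatr_eq0 -?lt0n ?fact_gt0//.
under eq_cvg do rewrite binE.
suff ffact_cvg : (fun N => (N.+1 ^_ n)%:R / N.+1%:R ^+ n) @ \oo --> (1 : R).
  by apply: (cvg_eq_lim (mul1r _)); apply: cvgM => //; exact: cvg_cst.
elim: n {binE} => [|n IHn].
  by under eq_cvg do rewrite divr1; exact: cvg_cst.
have ratio_cvg : (fun N => (N.+1 - n)%:R / N.+1%:R) @ \oo --> (1 : R).
  have : (fun N => 1 - n%:R * harmonic N) @ \oo --> (1 - n%:R * 0 : R).
    apply: cvgB; first exact: cvg_cst.
    by apply: cvgM; [exact: cvg_cst | exact: cvg_harmonic].
  rewrite mulr0 subr0; apply: cvg_trans; apply: near_eq_cvg; near=> N.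
  (* The subtraction of naturals is truncated, so it agrees with the real one only from here on. *)
  have nN : (n <= N.+1)%N by apply: leqW; near: N; exists n.
  by rewrite natrB// /harmonic /=; field; rewrite nat1r pnatr_eq0.
apply: (cvg_eq_lim (mulr1 _)).
under eq_cvg do rewrite ffactnSr natrM exprSr invfM mulrACA.
by apply: cvgM.
Unshelve. all: by end_near. Qed.

Lemma cvg_approx_coef (R : realType) (d : nat) (b : 'I_d -> R) (n : nat) :
  approx_coef b ^~ n @ \oo --> bessel_coef b n.
Proof.
rewrite /bessel_coef /approx_coef invfM -prodfV.
apply: cvgM; first exact: cvg_binomial_ratio.
apply: (cvg_big mul_continuous) => i _.
apply: (cvg_eq_lim (mul1r _)); apply: cvgM; last exact: cvg_cst.
exact: cvg_pochhammer_ratio.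
Qed.

Lemma approx_coef_ge0 (R : realType) (d : nat) (b : 'I_d -> R) (N n : nat) :
  (forall i, 0 < b i) -> 0 <= approx_coef b N n.
Proof.
move=> b_gt0; rewrite /approx_coef mulr_ge0 ?divr_ge0 ?exprn_ge0//.
rewrite prodr_ge0// => i _.
by rewrite !divr_ge0 ?exprn_ge0// ltW// pochhammer_gt0// ltr_wpDr.
Qed.

Lemma pochhammer_ge_exp (R : numFieldType) (b : R) (n : nat) :
  0 < b -> b ^+ n <= pochhammer b n.
Proof.
move=> b_gt0; rewrite -[n in _ ^+ n]card_ord -prodr_const ler_prod// => i _.
by rewrite ltW//= lerDl.
Qed.

(** With M = N + 1, the coefficient vanishes for n > M. Otherwise 'C(M, n) <= M^n / n!, (b)_n >=
    b^n, and b + M + k <= (b + 2) M for k < n. The bound is summable and free of N. *)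
Lemma approx_coef_le (R : realType) (d : nat) (b : 'I_d -> R) (N n : nat) :
  (forall i, 0 < b i) ->
  approx_coef b N n <= (\prod_(i < d) ((b i + 2) / b i)) ^+ n / n`!%:R.
Proof.
move=> b_gt0; rewrite [leRHS]mulrC.
have [nN|Nn] := leqP n N.+1; last first.
  rewrite /approx_coef bin_small// !mul0r mulr_ge0// exprn_ge0//.
  rewrite prodr_ge0// => i _.
  by rewrite divr_ge0 ?ltW// addr_gt0.
have M_gt0 : 0 < N.+1%:R :> R by rewrite ltr0n.
rewrite /approx_coef ler_pM//.
- apply: prodr_ge0 => i _.
  by rewrite !divr_ge0 ?exprn_ge0// ltW// pochhammer_gt0// ltr_wpDr.
- rewrite ler_pdivrMr ?exprn_gt0// ler_pdivlMl ?ltr0n ?fact_gt0//.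
  rewrite -natrX -natrM ler_nat mulnC bin_ffact ffact_prod.
  rewrite -[n in (_ ^ n)%N]card_ord -prod_nat_const leq_prod// => k _.
  exact: leq_subr.
- rewrite -prodrXl ler_prod// => i _; apply/andP; split.
    by rewrite !divr_ge0 ?exprn_ge0// ltW// pochhammer_gt0// ltr_wpDr.
  rewrite expr_div_n ler_pM ?invr_ge0//.
  + by rewrite divr_ge0 ?exprn_ge0// ltW// pochhammer_gt0// ltr_wpDr.
  + by rewrite ltW// pochhammer_gt0.
  + rewrite ler_pdivrMr ?exprn_gt0// -exprMn.
    rewrite -[n in _ ^+ n]card_ord -prodr_const ler_prod// => k _.
    rewrite -addrA addr_ge0 ?(ltW (b_gt0 i)) ?addr_ge0//=.
    have M_ge1 : 1 <= N.+1%:R :> R by rewrite ler1n.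
    have kM : k%:R <= N.+1%:R :> R.
      by rewrite ler_nat (leq_trans (ltnW (ltn_ord k))).
    have : b i <= b i * N.+1%:R by rewrite ler_peMr// ltW.
    lra.
  + by rewrite lef_pV2 ?posrE ?pochhammer_gt0 ?exprn_gt0// pochhammer_ge_exp.
Qed.

(** * Passage to the limit in the approximants *)

Lemma ultra_fmap (T U : Type) (f : T -> U) (F : set_system T) :
  UltraFilter F -> UltraFilter (f @ F).
Proof.
move=> FU; apply: Build_UltraFilter => G GF fFG.
apply/seteqP; split=> // A GA.
have [//|FnA] := in_ultra_setVsetC (f @^-1` A) FU.
have : G (A `&` ~` A) by apply: filterI => //; exact: fFG.
by rewrite setICr => /filter_not_empty.
Qed.

(** The filter plays the role of a convergent subsequence: the image of an ultrafilter refining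
    [\oo] is an ultrafilter containing [K], so it converges in [K]. *)
Lemma compact_subsequence_filter (T : topologicalType) (K : set T)
    (u : nat -> T) :
  compact K -> (\forall N \near \oo, K (u N)) ->
  exists F : set_system nat, [/\ ProperFilter F, \oo `<=` F &
    exists2 x, K x & u @ F --> x].
Proof.
move=> K_compact Ku; have [F [FU oo_F]] := @ultraFilterLemma _ \oo _.
exists F; split=> //; first exact: ultra_proper.
move: K_compact; rewrite compact_ultra.
move=> /(_ _ (ultra_fmap u FU)) [|x [Kx ux]]; first exact: oo_F.
by exists x.
Qed.

Definition bessel_series (R : realType) (d : nat) (b : 'I_d -> R) (t : R) : R :=
  limn (series (fun n => (-1) ^+ n * bessel_coef b n * t ^+ n)).

Lemma cvg_exprn (R : realType) (T : Type) (F : set_system T) (f : T -> R)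
    (l : R) (n : nat) :
  Filter F -> f @ F --> l -> f x ^+ n @[x --> F] --> l ^+ n.
Proof.
move=> FF fl.
exact: (@continuous_cvg _ R R F FF f (fun x => x ^+ n) l
  (@exprn_continuous R n l) fl).
Qed.

(** The evaluation points move with N, so that roots can be followed to the limit. Tannery's theorem
    applies with the majorant (K T)^n / n!. *)
Lemma cvg_bessel_series (R : realType) (d : nat) (b : 'I_d -> R)
    (p : nat -> {poly R}) (F : set_system nat) (t : R ^nat) (T l : R) :
  (forall i, 0 < b i) ->
  (forall N n, (p N)`_n = (-1) ^+ n * approx_coef b N n) ->
  ProperFilter F -> \oo `<=` F -> (\forall N \near F, `|t N| <= T) ->
  t @ F --> l ->
  cvgn (series (fun n => (-1) ^+ n * bessel_coef b n * l ^+ n)) /\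
  (p N).[t N] @[N --> F] --> bessel_series b l.
Proof.
move=> b_gt0 pE FF oo_F tT tl; set K := \prod_(i < d) ((b i + 2) / b i).
apply: (@tannery _ _ (fun N n => (p N)`_n * t N ^+ n) _ (exp_coeff (K * T))).
- near=> N => n; rewrite pE -mulrA normrMsign normrM.
  rewrite ger0_norm ?approx_coef_ge0//.
  have tN : `|t N| <= T by near: N.
  rewrite /exp_coeff /= exprMn [leRHS]mulrAC.
  apply: ler_pM; [exact: approx_coef_ge0 | by [] | exact: approx_coef_le |].
  by rewrite normrX lerXn2r ?nnegrE// (le_trans _ tN).
- exact: is_cvg_series_exp_coeff.
- move=> n; under eq_cvg do rewrite pE.
  apply: cvgM; first apply: cvgM; first exact: cvg_cst.
    apply: cvg_trans (@cvg_approx_coef _ _ b n).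
    by move=> A; exact: oo_F.
  exact: cvg_exprn.
- by move=> N; exact: series_coef_poly.
Unshelve. all: by end_near. Qed.

Lemma prod_lt_prod_addr1 (R : realFieldType) (d : nat) (b : 'I_d.+1 -> R) :
  (forall i, 0 < b i) -> \prod_(i < d.+1) b i < \prod_(i < d.+1) (b i + 1).
Proof.
move=> b_gt0; rewrite !big_ord_recl.
have le_tail : \prod_(i < d) b (lift ord0 i) <=
    \prod_(i < d) (b (lift ord0 i) + 1).
  by rewrite ler_prod// => i _; rewrite ltW//= lerDl.
apply: (le_lt_trans (ler_wpM2l (ltW (b_gt0 _)) le_tail)).
rewrite ltr_pM2r ?ltrDl// prodr_gt0// => i _.
by rewrite addr_gt0.
Qed.

Section NewtonLimits.
Variables (R : realType) (T : Type) (F : set_system T) (FF : Filter F).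
Variables (f1 f2 f3 f4 : T -> R) (l1 l2 l3 l4 : R).
Hypotheses (cvg1 : f1 @ F --> l1) (cvg2 : f2 @ F --> l2).
Hypotheses (cvg3 : f3 @ F --> l3) (cvg4 : f4 @ F --> l4).

Lemma cvg_newton2 : newton2 (f1 x) (f2 x) @[x --> F] --> newton2 l1 l2.
Proof.
apply: cvgB; first exact: cvg_exprn.
by apply: cvgM => //; exact: cvg_cst.
Qed.

Lemma cvg_newton3 :
  newton3 (f1 x) (f2 x) (f3 x) @[x --> F] --> newton3 l1 l2 l3.
Proof.
by do ![by [] | exact: cvg_cst | exact: cvg_exprn |
        apply: cvgB | apply: cvgM | apply: cvgD].
Qed.

Lemma cvg_newton4 :
  newton4 (f1 x) (f2 x) (f3 x) (f4 x) @[x --> F] --> newton4 l1 l2 l3 l4.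
Proof.
by do ![by [] | exact: cvg_cst | exact: cvg_exprn |
        apply: cvgB | apply: cvgM | apply: cvgD].
Qed.

End NewtonLimits.

Lemma bessel_coefE (R : realType) (d : nat) (b : 'I_d -> R) (n : nat) :
  bessel_coef b n = (n`!%:R * \prod_(0 <= k < n) \prod_(i < d) (b i + k%:R))^-1.
Proof. by rewrite big_mkord /bessel_coef /pochhammer exchange_big. Qed.

Lemma bessel_coef_gt0 (R : realType) (d : nat) (b : 'I_d -> R) (n : nat) :
  (forall i, 0 < b i) -> 0 < bessel_coef b n.
Proof.
move=> b_gt0; rewrite invr_gt0 mulr_gt0 ?ltr0n ?fact_gt0// prodr_gt0// => i _.
exact: pochhammer_gt0.
Qed.

(** The root is a cluster point of the least roots of the approximants. These are eventually bounded
    because s_2 > 0, and the cluster point is positive because each least root times its first power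
    sum is at least 1. *)
Lemma bessel_series_least_root (R : realType) (d : nat) (b : 'I_d -> R)
    (e := bessel_coef b) (s1 := e 1) (s2 := newton2 (e 1) (e 2))
    (s3 := newton3 (e 1) (e 2) (e 3)) (s4 := newton4 (e 1) (e 2) (e 3) (e 4)) :
  (forall i, 0 < b i) -> 0 < s2 ->
  exists t : R, [/\ 0 < t, bessel_series b t = 0,
    forall u : R, 0 <= u -> u < t -> 0 < bessel_series b u &
    [/\ 1 <= t ^+ 3 * s3, t * (s2 - t * s3) <= s1 - t * s2,
      t * (s3 - t * s4) <= s2 - t * s3 & t * s4 <= s3]].
Proof.
move=> b_gt0 s2_gt0; have s1_gt0 : 0 < s1 by exact: bessel_coef_gt0.
pose a := approx_coef b.
pose m1 N := a N 1%N; pose m2 N := newton2 (a N 1%N) (a N 2%N).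
pose m3 N := newton3 (a N 1%N) (a N 2%N) (a N 3%N).
pose m4 N := newton4 (a N 1%N) (a N 2%N) (a N 3%N) (a N 4%N).
have a1_gt0 N : 0 < a N 1%N.
  rewrite /a /approx_coef bin1 mulr_gt0 ?divr_gt0 ?exprn_gt0 ?ltr0n//.
  apply: prodr_gt0 => i _.
  rewrite !divr_gt0 ?exprn_gt0 ?ltr0n ?pochhammer_gt0//.
  by rewrite ltr_wpDr.
have /choice[pt ptP] : forall N, exists pt : {poly R} * R,
    [/\ forall n, pt.1`_n = (-1) ^+ n * a N n, 0 < pt.2, pt.1.[pt.2] = 0,
    forall u r : R, 0 <= u -> u <= r * pt.2 -> 0 <= r -> r < 1 ->
      expR (- (u * m1 N) / (1 - r)) <= pt.1.[u] &
    [/\ 1 <= pt.2 * m1 N, 1 <= pt.2 ^+ 3 * m3 N,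
      pt.2 * (m2 N - pt.2 * m3 N) <= m1 N - pt.2 * m2 N,
      pt.2 * (m3 N - pt.2 * m4 N) <= m2 N - pt.2 * m3 N &
      pt.2 * m4 N <= m3 N]].
  move=> N; have [p p_pos pE] := approx_pos_product N b_gt0.
  have [| t [t_gt0 pt0 p_ge moments]] := pos_product_least_root p_pos.
    by rewrite pE expr1 mulN1r opprK gt_eqF.
  exists (p, t); split=> //=.
    move: p_ge; rewrite pE expr1 mulN1r opprK; exact.
  move: moments; rewrite !pE !exprS expr0.
  by rewrite !(mulr1, mulN1r, opprK) !mul1r.
pose p N := (pt N).1; pose t N := (pt N).2.
have pE N n : (p N)`_n = (-1) ^+ n * approx_coef b N n.
  by have [+ _ _ _ _] := ptP N.
have t_gt0 N : 0 < t N by have [_ + _ _ _] := ptP N.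
have a_cvg n : a N n @[N --> \oo] --> e n by exact: cvg_approx_coef.
have m2_cvg : m2 N @[N --> \oo] --> s2 by exact: cvg_newton2.
have T_gt0 : 0 < s2 / 2 by rewrite divr_gt0.
(* The moment inequalities give t_N m2 <= m1, where eventually m2 >= s2 / 2 and m1 <= s1 + 1. *)
pose T := (s1 + 1) / (s2 / 2).
have t_bound : \forall N \near \oo, `[0, T]%classic (t N).
  near=> N; rewrite /= in_itv /= ltW//= /T ler_pdivlMr//.
  have m1N : m1 N <= s1 + 1.
    near: N; apply: cvgr_le (a_cvg 1%N) _ _; by rewrite ltrDl.
  have m2N : s2 / 2 <= m2 N.
    near: N; apply: cvgr_ge m2_cvg _ _; lra.
  apply: le_trans m1N; apply: (le_trans (ler_wpM2l (ltW (t_gt0 N)) m2N)).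
  have [_ _ _ _ [_ _ m12 m23 m34]] := ptP N.
  rewrite -subr_ge0; apply: le_trans m12; rewrite mulr_ge0 ?(ltW (t_gt0 N))//.
  by apply: le_trans m23; rewrite mulr_ge0 ?(ltW (t_gt0 N)) ?subr_ge0.
have [F [FF oo_F [l lT t_cvg]]] :=
  compact_subsequence_filter (@segment_compact R 0 T) t_bound.
have aF_cvg n : a N n @[N --> F] --> e n.
  by apply: cvg_trans (a_cvg n) => A; exact: oo_F.
have m1F : m1 @ F --> s1 by exact: aF_cvg.
have m2F : m2 @ F --> s2 by exact: cvg_newton2.
have m3F : m3 @ F --> s3 by exact: cvg_newton3.
have m4F : m4 @ F --> s4 by exact: cvg_newton4.
have tF_bound : \forall N \near F, `|t N| <= T.
  apply: oo_F; apply: filterS t_bound => N.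
  rewrite /= in_itv /= => /andP[t_ge0 tT].
  by rewrite ger0_norm.
have l_gt0 : 0 < l.
  have : 1 <= l * s1.
    apply: cvgr_to_ge (cvgM t_cvg m1F) _; near=> N.
    by have [_ _ _ _ []] := ptP N.
  move=> ls1; rewrite -(pmulr_lgt0 _ s1_gt0); exact: lt_le_trans ls1.
exists l; split=> //.
- have [_ pl] := cvg_bessel_series b_gt0 pE FF oo_F tF_bound t_cvg.
  apply/esym; apply: cvg_unique pl => //.
  have -> : (fun N => (p N).[t N]) = (fun=> 0).
    by apply/funext => N; have [_ _ + _ _] := ptP N.
  exact: cvg_cst.
- move=> u u_ge0 u_lt.
  have u_bound : \forall N \near F, `|(fun=> u) N| <= u.
    by near=> N; rewrite ger0_norm.
  have [_ pu] := cvg_bessel_series b_gt0 pE FF oo_F u_bound (cvg_cst u).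
  (* The midpoint of u and l, relative to l: then r < 1 and u < r l, so u <= r t_N for N far along
     [F], and the exponential bound at u becomes independent of N. *)
  pose r := (u + l) / 2 / l.
  have r_lt1 : r < 1 by rewrite /r ltr_pdivrMr//; lra.
  have r_ge0 : 0 <= r by rewrite /r !divr_ge0 ?addr_ge0 ?(ltW l_gt0).
  have rl : u < r * l by rewrite /r divfK ?gt_eqF//; lra.
  apply: (@lt_le_trans _ _ (expR (- (u * (s1 + 1)) / (1 - r)))).
    exact: expR_gt0.
  apply: cvgr_to_ge pu _; near=> N.
  have rtN : u <= r * t N.
    near: N; apply: cvgr_ge rl; apply: cvgM => //; exact: cvg_cst.
  have m1N : m1 N <= s1 + 1.
    near: N; apply: cvgr_le m1F _ _; by rewrite ltrDl.
  have [_ _ _ p_ge _] := ptP N.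
  apply: le_trans (p_ge u r u_ge0 rtN r_ge0 r_lt1).
  by rewrite ler_expR ler_pM2r ?invr_gt0 ?subr_gt0// lerN2 ler_wpM2l.
- split.
  + have lhs : t N ^+ 3 * m3 N @[N --> F] --> l ^+ 3 * s3.
      by apply: cvgM => //; exact: cvg_exprn.
    apply: cvgr_to_ge lhs _; near=> N.
    by have [_ _ _ _ []] := ptP N.
  + have lhs : t N * (m2 N - t N * m3 N) @[N --> F] --> l * (s2 - l * s3).
      by apply: cvgM => //; apply: cvgB => //; exact: cvgM.
    have rhs : m1 N - t N * m2 N @[N --> F] --> s1 - l * s2.
      by apply: cvgB => //; exact: cvgM.
    apply: ler_cvg_to lhs rhs _; near=> N.
    by have [_ _ _ _ []] := ptP N.
  + have lhs : t N * (m3 N - t N * m4 N) @[N --> F] --> l * (s3 - l * s4).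
      by apply: cvgM => //; apply: cvgB => //; exact: cvgM.
    have rhs : m2 N - t N * m3 N @[N --> F] --> s2 - l * s3.
      by apply: cvgB => //; exact: cvgM.
    apply: ler_cvg_to lhs rhs _; near=> N.
    by have [_ _ _ _ []] := ptP N.
  + apply: ler_cvg_to (cvgM t_cvg m4F) m3F _; near=> N.
    by have [_ _ _ _ []] := ptP N.
Unshelve. all: by end_near. Qed.

(** Convergence comes from the domination of the approximants, evaluated at a constant sequence of
    points. *)
Lemma is_cvg_bessel_series (R : realType) (d : nat) (b : 'I_d -> R) (t : R) :
  (forall i, 0 < b i) ->
  cvgn (series (fun n => (-1) ^+ n * bessel_coef b n * t ^+ n)).
Proof.
move=> b_gt0; have /choice[p pE] N : exists p : {poly R},
    forall n, p`_n = (-1) ^+ n * approx_coef b N n.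
  by have [p _ pE] := approx_pos_product N b_gt0; exists p.
have t_bound : \forall N \near \oo, `|(fun=> t) N| <= `|t| by near=> N.
by have [] := cvg_bessel_series b_gt0 pE _ (@subset_refl _ _) t_bound (cvg_cst t).
Unshelve. all: by end_near. Qed.

(** * The first positive zero *)

Section RealArgument.
Local Open Scope complex_scope.

Lemma cvg_real_complex (R : realType) (u : R ^nat) (l : R)
    (K := R[i] : numFieldType) :
  u @ \oo --> l -> ((u n)%:C : K) @[n --> \oo] --> (l%:C : K).
Proof.
move=> /cvgrPdist_lt ul; apply/cvgrPdist_lt => e e_gt0.
(* A positive element of [R[i]] is real, so [e] is also a real tolerance. *)
have eE : e = (complex.Re e)%:C by rewrite RRe_real// gtr0_real.
have Re_gt0 : 0 < complex.Re e by rewrite -ltcR -eE.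
near=> n; rewrite -rmorphB normc_def /= expr0n addr0 sqrtr_sqr eE ltcR.
by near: n; exact: ul.
Unshelve. all: by end_near. Qed.

(** Term by term the complex series is the image of the real one, whose convergence makes both
    limits genuine. *)
Lemma hyper_besselC_real (R : realType) (d : nat) (alpha : 'I_d -> R) (x : R) :
  (forall i, -1 < alpha i) ->
  hyper_besselC alpha x%:C =
    (bessel_series (fun i => alpha i + 1) ((x / d.+1%:R) ^+ d.+1))%:C.
Proof.
move=> alpha_gt; have b_gt0 i : 0 < alpha i + 1 by rewrite -ltrBlDr sub0r.
rewrite /hyper_besselC /hyper_bessel; set u := (X in series X).
set v := fun n : nat => (-1) ^+ n * bessel_coef (fun i => alpha i + 1) n *
  ((x / d.+1%:R) ^+ d.+1) ^+ n.
have uE n : u n = (v n)%:C.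
  rewrite /u /v /bessel_coef !rmorphM /= rmorphXn rmorphN1 fmorphV !rmorphM /=.
  rewrite !rmorphXn /= rmorphM /= fmorphV !rmorph_nat rmorph_prod -exprM mulnC.
  congr (_ / (_ * _) * _); apply: eq_bigr => i _.
  rewrite /pochhammer rmorph_prod; apply: eq_bigr => k _.
  by rewrite !rmorphD rmorph1 rmorph_nat.
have -> : series u = (fun n => (series v n)%:C).
  by apply/funext => n; rewrite /series /= rmorph_sum; apply: eq_bigr => k _.
have limE (K : numFieldType) (w : K ^nat) (l : K) : w @ \oo --> l -> limn w = l.
  by apply: cvg_lim; exact: norm_hausdorff.
apply: (limE (R[i] : numFieldType)).
apply: cvg_real_complex; exact: is_cvg_bessel_series.
Qed.

End RealArgument.

(** Clearing denominators in t s_2 < e_1 and t s_3 < s_2 gives the upper bounds; s_3 > 0 makes the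
    last denominator positive. The square root bound is 1 < t^2 s_2, and it implies a < t since b /
    (b - a) >= 1. *)
Lemma bounds_closed_form (R : rcfType) (a b c t : R) (e1 := a^-1)
    (e2 := (2 * a * b)^-1) (e3 := (6 * a * b * c)^-1) (s2 := newton2 e1 e2)
    (s3 := newton3 e1 e2 e3) :
  0 < a -> a < b -> 0 < c -> 0 < t -> 0 < s3 ->
  1 < t ^+ 2 * s2 -> t * s3 < s2 -> t * s2 < e1 ->
  [/\ a < t, t < a * b / (b - a), a * Num.sqrt (b / (b - a)) < t &
    t < 2 * (a * b * c - a ^+ 2 * c) / (a ^+ 2 - 3 * a * c + 2 * b * c)].
Proof.
move=> a_gt0 ab c_gt0 t_gt0 s3_gt0 lt2 lt3 lt1.
have b_gt0 := lt_trans a_gt0 ab; have ba_gt0 : 0 < b - a by rewrite subr_gt0.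
have [an bn cn ban] : [/\ a != 0, b != 0, c != 0 & b - a != 0].
  by rewrite !gt_eqF.
have s2E : s2 = (b - a) / (a ^+ 2 * b).
  by rewrite /s2 /newton2 /e1 /e2; field; rewrite an bn.
have s3E : s3 = (a ^+ 2 - 3 * a * c + 2 * b * c) / (2 * a ^+ 3 * b * c).
  by rewrite /s3 /newton3 /e1 /e2 /e3; field; rewrite an bn cn.
have den_gt0 : 0 < a ^+ 2 - 3 * a * c + 2 * b * c.
  by move: s3_gt0; rewrite s3E pmulr_lgt0// invr_gt0 !mulr_gt0 ?exprn_gt0.
have sq_gt : b / (b - a) < (t / a) ^+ 2.
  rewrite ltr_pdivrMr// expr_div_n.
  have : 1 * b < t ^+ 2 * s2 * b by rewrite ltr_pM2r.
  by rewrite mul1r s2E; congr (_ < _); field; rewrite an bn.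
have sqrt_lt : a * Num.sqrt (b / (b - a)) < t.
  have ta_gt0 : 0 < t / a by rewrite divr_gt0.
  rewrite -ltr_pdivlMl// [ltRHS]mulrC -(gtr0_norm ta_gt0) -sqrtr_sqr.
  by rewrite ltr_sqrt// exprn_gt0.
split=> //.
- apply: le_lt_trans sqrt_lt; rewrite ler_peMr ?(ltW a_gt0)//.
  by rewrite -[leLHS]sqrtr1 ler_wsqrtr// ler_pdivlMr// mul1r lerBlDr lerDl ltW.
- have : t * s2 * (a ^+ 2 * b) < e1 * (a ^+ 2 * b).
    by rewrite ltr_pM2r ?mulr_gt0 ?exprn_gt0.
  by rewrite ltr_pdivlMr// s2E /e1; congr (_ < _); field; rewrite ?an ?bn.
- have : t * s3 * (2 * a ^+ 3 * b * c) < s2 * (2 * a ^+ 3 * b * c).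
    by rewrite ltr_pM2r// !mulr_gt0 ?exprn_gt0.
  rewrite ltr_pdivlMr// s2E s3E.
  by congr (_ < _); field; rewrite ?an ?bn ?cn.
Qed.

Lemma root_exists (R : realType) (x : R) (n : nat) :
  0 < x -> exists2 y : R, 0 < y & y ^+ n.+1 = x.
Proof.
move=> x_gt0; exists (x `^ n.+1%:R^-1); first exact: powR_gt0.
by rewrite -powR_mulrn ?powR_ge0// -powRrM mulVf ?pnatr_eq0// powRr1// ltW.
Qed.

Unset Implicit Arguments.

Theorem theorem4 (R : realType) (d : nat) (alpha : 'I_d -> R) :
  (1 <= d)%N ->
  (forall i : 'I_d, -1 < alpha i) ->
  exists j : R,
    [/\ first_positive_zero (hyper_besselC alpha) j,
        d.+1%:R ^+ d.+1 * A alpha < j ^+ d.+1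
          < d.+1%:R ^+ d.+1 * A alpha * B alpha / (B alpha - A alpha)
      & d.+1%:R ^+ d.+1 * A alpha * Num.sqrt (B alpha / (B alpha - A alpha))
          < j ^+ d.+1
          < 2 * d.+1%:R ^+ d.+1
              * (A alpha * B alpha * C alpha - A alpha ^+ 2 * C alpha)
            / (A alpha ^+ 2 - 3 * A alpha * C alpha
               + 2 * B alpha * C alpha)].
Proof.
(* From here [d.+1] is the number of parameters, so d + 1 in the statement reads [d.+2]. *)
case: d alpha => [|d] alpha // _ alpha_gt.
pose b i := alpha i + 1; pose P n := \prod_(i < d.+1) (b i + n%:R).
have b_gt0 i : 0 < b i by rewrite /b -ltrBlDr sub0r.
have P_gt0 n : 0 < P n by apply: prodr_gt0 => i _; rewrite ltr_wpDr.
have AE : A alpha = P 0%N by apply: eq_bigr => i _; rewrite addr0.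
have BE : B alpha = P 1%N by apply: eq_bigr => i _; rewrite /b; ring.
have CE : C alpha = P 2%N by apply: eq_bigr => i _; rewrite /b; ring.
have e1E : bessel_coef b 1 = (P 0%N)^-1 by rewrite bessel_coefE big_nat1 mul1r.
have e2E : bessel_coef b 2 = (2 * P 0%N * P 1%N)^-1.
  by rewrite bessel_coefE big_nat_recr//= big_nat1 mulrA.
have e3E : bessel_coef b 3 = (6 * P 0%N * P 1%N * P 2%N)^-1.
  by rewrite bessel_coefE 2?big_nat_recr//= big_nat1 !mulrA.
have e4E : bessel_coef b 4 = (24 * P 0%N * P 1%N * P 2%N * P 3%N)^-1.
  by rewrite bessel_coefE 3?big_nat_recr//= big_nat1 !mulrA.
have P01 : P 0%N < P 1%N.
  have -> : P 0%N = \prod_(i < d.+1) b i.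
    by apply: eq_bigr => i _; rewrite addr0.
  exact: prod_lt_prod_addr1.
have [P0n P1n] : P 0%N != 0 /\ P 1%N != 0 by rewrite !gt_eqF.
have s2_gt0 : 0 < newton2 (bessel_coef b 1) (bessel_coef b 2).
  have -> : newton2 (bessel_coef b 1) (bessel_coef b 2) =
      (P 1%N - P 0%N) / (P 0%N ^+ 2 * P 1%N).
    by rewrite e1E e2E /newton2; field; rewrite P0n P1n.
  by rewrite divr_gt0 ?subr_gt0 ?mulr_gt0 ?exprn_gt0.
have [t [t_gt0 t_root t_least]] := bessel_series_least_root b_gt0 s2_gt0.
rewrite e1E e2E e3E e4E => moments.
have [_ _ convex] := increasing_convex_prod (index_enum 'I_d.+1) b_gt0.
have cm := third_difference_prodV_gt0 b_gt0.
have [lt2 lt3 lt1] := least_root_bounds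
  (P_gt0 0%N) (P_gt0 1%N) (P_gt0 2%N) (P_gt0 3%N) convex cm t_gt0 moments.
have s3_gt0 : 0 < newton3 (P 0%N)^-1 (2 * P 0%N * P 1%N)^-1
    (6 * P 0%N * P 1%N * P 2%N)^-1.
  rewrite -(pmulr_rgt0 _ (exprn_gt0 3 t_gt0)).
  by have [le_s3 _ _ _] := moments; exact: lt_le_trans ltr01 le_s3.
have [bnd1 bnd2 bnd3 bnd4] := bounds_closed_form
  (P_gt0 0%N) P01 (P_gt0 2%N) t_gt0 s3_gt0 lt2 lt3 lt1.
(* This undoes the substitution t = (j / (d + 2))^(d + 2) in the shifted index. *)
have [y y_gt0 yE] := root_exists d.+1 t_gt0.
have D_gt0 : 0 < d.+2%:R :> R by rewrite ltr0n.
have Dn_gt0 : 0 < d.+2%:R ^+ d.+2 :> R by rewrite exprn_gt0.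
exists (y * d.+2%:R); split.
- split; first exact: mulr_gt0.
    by rewrite hyper_besselC_real// mulfK ?gt_eqF// yE -/b t_root.
  move=> x x_gt0; rewrite hyper_besselC_real// -/b => /complexI x_root.
  rewrite -ler_pdivlMr// leNgt; apply/negP => x_lt.
  (* A smaller positive zero would map to a point before [t], where the series is positive. *)
  have : 0 < bessel_series b ((x / d.+2%:R) ^+ d.+2).
    apply: t_least; first by rewrite exprn_ge0// divr_ge0 ?ltW.
    by rewrite -yE ltrXn2r// divr_ge0 ?ltW.
  by rewrite x_root ltxx.
- rewrite AE BE exprMn yE; move: (_ ^+ d.+2) Dn_gt0 => Q Q_gt0.
  by rewrite [t * Q]mulrC -!mulrA !ltr_pM2l// bnd1 mulrA.
- rewrite AE BE CE exprMn yE; move: (_ ^+ d.+2) Dn_gt0 => Q Q_gt0.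
  rewrite [t * Q]mulrC [2 * Q]mulrC -[_ * Num.sqrt _]mulrA ltr_pM2l// bnd3 /=.
  by rewrite -[Q * 2 * _]mulrA -[Q * _ / _]mulrA ltr_pM2l.
Qed.
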